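(* Every CSS code on $n$ physical qubits can be expressed by exactly one ZX diagram in encoder-respecting form (with output nodes numbered $1,\dots,n$) satisfying the following three rules. (Bipartite rule) The nodes split into two groups: one consisting of the input nodes, which are all $X$ nodes, together with the output $X$ nodes; the other consisting of the output $Z$ nodes. The only interior edges are between nodes of different groups. (Phase-free rule) All input and output nodes have phase $0$, and there are no local operations on any free edges. (RREF rule) The adjacency matrix between the input $X$ nodes (rows) and the output $Z$ nodes (columns, in increasing order of number) is in reduced row echelon form over $\mathbb{F}_2$. The adjacency matrix between the output $X$ nodes (rows) and all $n$ output nodes (columns), in which each output $X$ node is marked as connected to itself, is also in reduced row echelon form (equivalently, no output $X$ node is connected to a lower-numbered output $Z$ node).
   Context: ZX diagrams are considered up to nonzero scalars. A $Z$ node of phase $\alpha$ with $a$ inputs and $b$ outputs is the tensor $|0\rangle^{\otimes b}\langle 0|^{\otimes a}+e^{i\alpha}|1\rangle^{\otimes b}\langle 1|^{\otimes a}$. An $X$ node of phase $\beta$ is $|+\rangle^{\otimes b}\langle +|^{\otimes a}+e^{i\beta}|-\rangle^{\otimes b}\langle -|^{\otimes a}$. An edge joining two nodes is a contraction of the corresponding indices. A ZX diagram with $k$ free input edges and $n$ free output edges thus represents a linear map $(\mathbb{C}^2)^{\otimes k}\to(\mathbb{C}^2)^{\otimes n}$. Encoder-respecting form: every node is a $Z$ or $X$ node and is either an input node (with exactly one free input edge) or an output node (with exactly one free output edge); there are $k$ input nodes and $n$ output nodes, the outputs are numbered $1,\dots,n$, inputs are connected only to outputs, outputs may be connected to each other,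 and in general local operations may sit on the free output edges. Interior edges here are simple edges without Hadamard gates. Encoders are assumed injective (non-degenerate), and an encoder is identified with its image: two encoders differing only by a unitary on the inputs are the same. Correspondingly the input-to-output adjacency matrix has full row rank $k$, and each input node has a pivot output node. A diagram expresses a code if the image of its linear map is the codespace. A CSS code is a stabilizer code on $n$ qubits (codespace = joint $+1$ eigenspace of a commuting group of Pauli operators with independent generators) whose stabilizer generators can be chosen so that each is either a tensor product of only $I$ and $Z$ or a tensor product of only $I$ and $X$ (with sign $+1$).
   Formalization: The claimed equivalence in the RREF rule fails (for span{|00>,|11>} two diagrams both give output matrix (1 1)), so uniqueness fails under reduced row echelon form alone; the formal rule also requires that no output X node is connected to a lower-numbered output Z node. *)

(* Defs.v *)
From HB Require Import structures.
From mathcomp Require Import all_boot all_order all_algebra.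
From mathcomp Require Import reals trigo.
From mathcomp Require Import complex spectral.

Set Implicit Arguments.
Unset Strict Implicit.
Unset Printing Implicit Defensive.

Import Order.TTheory GRing.Theory Num.Theory.
Local Open Scope ring_scope.

(** * Qubit registers *)

Definition bits (n : nat) := {ffun 'I_n -> bool}.

(* (C^2)^{(x) n}: the amplitudes of a vector in the computational basis. *)
Definition qstate (R : realType) (n : nat) := {ffun bits n -> R[i]^o}.

Section LinearMaps.
Context {R : realType}.

Definition kernel_fun m n (K : bits m -> bits n -> R[i])
    (psi : qstate R n) : qstate R m :=
  [ffun y => \sum_(x : bits n) K y x * psi x].

Lemma kernel_fun_linear m n (K : bits m -> bits n -> R[i]) :
  linear (kernel_fun K : qstate R n -> qstate R m).
Proof.
move=> a u v; apply/ffunP => y; rewrite !ffunE scaler_sumr -big_split /=.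
by apply: eq_bigr => x _; rewrite !ffunE mulrDr; congr (_ + _); apply: mulrCA.
Qed.

HB.instance Definition _ m n (K : bits m -> bits n -> R[i]) :=
  GRing.isLinear.Build R[i] (qstate R n) (qstate R m) _ (kernel_fun K)
    (@kernel_fun_linear m n K).

(* The linear map with matrix entries <y|M|x> = K y x. *)
Definition map_of_kernel m n (K : bits m -> bits n -> R[i]) :
    'Hom(qstate R n, qstate R m) := linfun (kernel_fun K).

Definition bit_ord (b : bool) : 'I_2 := inord b.

Definition tensor_op n (U : 'I_n -> 'M[R[i]]_2) : 'End(qstate R n) :=
  map_of_kernel (fun y x => \prod_(q < n) U q (bit_ord (y q)) (bit_ord (x q))).

End LinearMaps.

(** * Stabilizer and CSS codes *)

Variant pauli := PauliI | PauliX | PauliY | PauliZ.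

Section Codes.
Context {R : realType}.

Definition pauli_mx (p : pauli) : 'M[R[i]]_2 :=
  match p with
  | PauliI => 1%:M
  | PauliX => \matrix_(r, c) (r != c)%:R
  | PauliY => \matrix_(r, c) ((r != c)%:R * ((-1) ^+ c * 'i))
  | PauliZ => \matrix_(r, c) ((r == c)%:R * (-1) ^+ c)
  end.

Record npauli (n : nat) := NPauli {
  pauli_neg : bool;
  pauli_letter : 'I_n -> pauli
}.

Definition pauli_op n (P : npauli n) : 'End(qstate R n) :=
  (-1) ^+ pauli_neg P *: tensor_op (fun q => pauli_mx (pauli_letter P q)).

(* Signed Pauli operators are involutions, so the submonoid generated by
   some of them is the subgroup they generate. *)
Inductive generated n m (g : 'I_m -> npauli n) (J : {set 'I_m}) :
    'End(qstate R n) -> Prop :=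
| generated_one : generated g J \1%VF
| generated_mul i A :
    i \in J -> generated g J A -> generated g J (pauli_op (g i) \o A)%VF.

Definition commuting n m (g : 'I_m -> npauli n) : Prop :=
  forall i j, (pauli_op (g i) \o pauli_op (g j))%VF =
              (pauli_op (g j) \o pauli_op (g i))%VF.

Definition independent n m (g : 'I_m -> npauli n) : Prop :=
  forall i, ~ generated g [set~ i] (pauli_op (g i)).

Definition stabilizer_code_of n m (g : 'I_m -> npauli n)
    (W : {vspace qstate R n}) : Prop :=
  [/\ commuting g, independent g &
      forall psi, psi \in W <-> (forall A, generated g setT A -> A psi = psi)].

Definition css_generator n (P : npauli n) : Prop :=
  pauli_neg P = false /\
  ((forall q, pauli_letter P q = PauliI \/ pauli_letter P q = PauliZ) \/
   (forall q, pauli_letter P q = PauliI \/ pauli_letter P q = PauliX)).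

Definition css_code n (W : {vspace qstate R n}) : Prop :=
  exists (m : nat) (g : 'I_m -> npauli n),
    stabilizer_code_of g W /\ (forall i, css_generator (g i)).

End Codes.

(** * ZX diagrams in encoder-respecting form *)

Variant color := ZColor | XColor.

Definition is_X (c : color) : bool := if c is XColor then true else false.

(* Node [inl i] is the i-th input node, [inr o] the o-th output node; each
   carries exactly one free edge. [edges] holds both orientations of every
   interior edge. [local_op o] sits on the free edge of output o, the identity
   matrix meaning that there is no local operation. *)
Record diagram (R : realType) (n : nat) := Diagram {
  nin : nat;
  node_color : {ffun 'I_nin + 'I_n -> color};
  node_phase : {ffun 'I_nin + 'I_n -> R};
  edges : {set ('I_nin + 'I_n) * ('I_nin + 'I_n)};
  local_op : {ffun 'I_n -> 'M[R[i]]_2}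
}.

Definition rref (F : fieldType) m n (A : 'M[F]_(m, n)) : Prop :=
  let leading (i : 'I_m) (j : 'I_n) :=
    A i j != 0 /\ (forall j' : 'I_n, (j' < j)%N -> A i j' = 0) in
  [/\ forall i i' : 'I_m, (i < i')%N -> row i A = 0 -> row i' A = 0,
      forall (i i' : 'I_m) (j j' : 'I_n),
        (i < i')%N -> leading i j -> leading i' j' -> (j < j')%N,
      forall i j, leading i j -> A i j = 1 &
      forall i i' j, leading i j -> i' != i -> A i' j = 0].

Section Diagrams.
Context {R : realType} {n : nat}.
Implicit Type D : diagram R n.

Definition node D := ('I_(nin D) + 'I_n)%type.

Definition adj D (u v : node D) : bool := (u, v) \in edges D.

(** ** Interpretation as a linear map *)

Definition expi (a : R) : R[i] := (cos a +i* sin a)%C.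

Definition ket0 (b : bool) : R[i] := (~~ b)%:R.
Definition ket1 (b : bool) : R[i] := b%:R.
Definition ketp (b : bool) : R[i] := (sqrtC 2)^-1.
Definition ketm (b : bool) : R[i] := (-1) ^+ b / sqrtC 2.

(* Component of |u>..|u><u|..<u| + e^{ia} |v>..|v><v|..<v| at the leg values s.
   Kets and bras need not be told apart: u and v have real entries. *)
Definition spider (u v : bool -> R[i]) (a : R) (s : seq bool) : R[i] :=
  \prod_(b <- s) u b + expi a * \prod_(b <- s) v b.

Definition node_tensor (c : color) : R -> seq bool -> R[i] :=
  match c with
  | ZColor => spider ket0 ket1
  | XColor => spider ketp ketm
  end.

(* An index value for every interior edge: the value on the edge uv is
   w (u, v) = w (v, u), and pairs that are not edges get the dummy value 0. *)
Definition edge_labelling D (w : {ffun node D * node D -> bool}) : bool :=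
  [forall u, forall v, (w (u, v) == w (v, u)) && (w (u, v) ==> adj u v)].

Definition free_bit D (x : bits (nin D)) (y : bits n) (v : node D) : bool :=
  match v with inl i => x i | inr o => y o end.

Definition contraction D (y : bits n) (x : bits (nin D)) : R[i] :=
  \sum_(w : {ffun node D * node D -> bool} | edge_labelling w)
    \prod_(v : node D)
      node_tensor (node_color D v) (node_phase D v)
        (free_bit x y v :: [seq w (v, u) | u <- enum {: node D} & adj v u]).

Definition diagram_map D : 'Hom(qstate R (nin D), qstate R n) :=
  (tensor_op (local_op D) \o map_of_kernel (@contraction D))%VF.

(** ** Encoders *)

(* Phases are angles modulo 2 pi, represented in [0, 2 pi). *)
Definition encoder_respecting D : Prop :=
  [/\ forall u v : node D, adj u v = adj v u,
      forall u : node D, ~~ adj u u,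
      forall i j : 'I_(nin D), ~~ @adj D (inl i) (inl j),
      forall u : node D, 0 <= node_phase D u < 2 * pi &
      forall o, local_op D o \is unitarymx].

Definition injective_encoder D : Prop := lker (diagram_map D) = 0%VS.

Definition expresses D (W : {vspace qstate R n}) : Prop :=
  limg (diagram_map D) = W.

(** ** The three rules *)

Definition in_X_group D (u : node D) : bool :=
  match u with
  | inl _ => true
  | inr o => is_X (node_color D (inr o))
  end.

Definition bipartite_rule D : Prop :=
  (forall i, node_color D (inl i) = XColor) /\
  (forall u v : node D, adj u v -> in_X_group u != in_X_group v).

Definition phase_free_rule D : Prop :=
  (forall u, node_phase D u = 0) /\ (forall o, local_op D o = 1%:M).

Definition X_outputs D : {set 'I_n} := [set o | is_X (node_color D (inr o))].
Definition Z_outputs D : {set 'I_n} := ~: X_outputs D.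

(* [enum_val] lists the elements of a set of ordinals in increasing order. *)
Definition input_Z_mx D : 'M['F_2]_(nin D, #|Z_outputs D|) :=
  \matrix_(i, j) (@adj D (inl i) (inr (enum_val j)))%:R.

Definition outputX_mx D : 'M['F_2]_(#|X_outputs D|, n) :=
  \matrix_(i, j)
    ((enum_val i == j) || @adj D (inr (enum_val i)) (inr j))%:R.

(* The last clause says that the pivot of each row of [outputX_mx] is the
   output X node of that row. Being in reduced row echelon form does not entail
   it: with n = 2, the row (1 1) also arises when the X node comes second. *)
Definition rref_rule D : Prop :=
  [/\ rref (input_Z_mx D),
      rref (outputX_mx D) &
      forall o o' : 'I_n, o \in X_outputs D -> o' \in Z_outputs D ->
        @adj D (inr o) (inr o') -> (o < o')%N].

End Diagrams.

(* Main.v *)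
Require Import Defs.
From mathcomp Require Import all_boot all_order all_algebra.
From mathcomp Require Import reals trigo.
From mathcomp Require Import complex spectral.

Set Implicit Arguments.
Unset Strict Implicit.
Unset Printing Implicit Defensive.

Import Order.TTheory GRing.Theory Num.Theory.
Local Open Scope ring_scope.

(** In a phase-free bipartite diagram a Z output copies its bit to all its edges
    and an X node imposes even parity. If [A] is the matrix from inputs to outputs
    and [H] the matrix [outputX_mx], the diagram therefore maps [phi] to
    [y |-> c * [H y = 0] * phi (A y)] with [c != 0]. It is injective iff [A] is
    onto when restricted to [ker H], and its image then consists of the vectors
    supported on [ker H] and constant on the cosets of [K = ker H :&: ker A].
    A CSS code is likewise given by a pair [K <= C]: the joint kernel [C] of the
    Z generators and the span [K] of the X generators. The image determines
    [ker H] and [K], and these determine [H] and [A] because a matrix in reduced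
    row echelon form without zero rows is determined by its kernel; conversely,
    reducing the two linear systems yields the diagram. *)

(** * Increasing enumerations of ordinals *)

Definition increasing k n (f : 'I_k -> 'I_n) : Prop :=
  forall i i' : 'I_k, (i < i')%N -> (f i < f i')%N.

Lemma increasing_mono k n (f : 'I_k -> 'I_n) :
  increasing f -> forall i i' : 'I_k, (f i < f i')%N = (i < i')%N.
Proof.
move=> fS i i'; case: (ltngtP i i') => [/fS-> //|/fS|/val_inj->]; last exact: ltnn.
by move=> lt; apply/negbTE; rewrite -leqNgt ltnW.
Qed.

Lemma increasing_inj k n (f : 'I_k -> 'I_n) : increasing f -> injective f.
Proof.
move=> fS i i' eqf; apply: val_inj; apply/eqP.
by case: ltngtP => // /fS; rewrite eqf ltnn.
Qed.

Lemma increasing_enum_val n (A : {set 'I_n}) :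
  increasing (fun i : 'I_#|A| => enum_val i).
Proof.
move=> i i' lt_ii'.
have srt : sorted ltn (map val (enum A)).
  rewrite /enum_mem /= -enumT sorted_map.
  apply: sorted_filter; first by move=> x y z; apply: ltn_trans.
  by rewrite -sorted_map val_enum_ord iota_ltn_sorted.
have szE : #|A| = size (enum A) by rewrite cardE.
have d := enum_val i.
rewrite !(enum_val_nth d) -!(nth_map d 0%N val) -?szE ?ltn_ord //.
by apply: (sorted_ltn_nth ltn_trans 0%N srt); rewrite ?inE ?size_map -?szE ?ltn_ord.
Qed.

(* The sequences of values are both the strictly sorted listing of the common image. *)
Lemma increasing_same_image k k' n (f : 'I_k -> 'I_n) (f' : 'I_k' -> 'I_n) :
    increasing f -> increasing f' -> codom f =i codom f' ->
  k = k' /\ forall (i : 'I_k) (i' : 'I_k'), i = i' :> nat -> f i = f' i'.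
Proof.
have srt l (h : 'I_l -> 'I_n) : increasing h -> sorted ltn (map val (codom h)).
  move=> hS; rewrite codomE -map_comp.
  have := iota_ltn_sorted 0 l; rewrite -val_enum_ord sorted_map.
  rewrite sorted_map; apply: sub_sorted => i j /=; apply: hS.
move=> fS f'S eq_im.
have eq_seq : codom f = codom f'.
  apply: (inj_map val_inj).
  apply: (irr_sorted_eq ltn_trans ltnn (srt _ _ fS) (srt _ _ f'S)) => x.
  by apply/mapP/mapP => -[y fy ->]; exists y; rewrite // ?eq_im // -eq_im.
have eqk : k = k' by have := congr1 size eq_seq; rewrite !size_codom !card_ord.
split=> // i i' eqi; subst k'.
have <- : i = i' by apply: val_inj.
have nth_codom (h : 'I_k -> 'I_n) : nth (f i) (codom h) i = h i.
  by rewrite codomE (nth_map i) ?size_enum_ord // nth_ord_enum.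
by rewrite -[LHS]nth_codom eq_seq nth_codom.
Qed.

(** * Reduced echelon systems *)

(* The rows of [S] indexed by [P] are the nonzero rows of a reduced row echelon
   form, each placed at the index of its own pivot column. *)
Definition reduced_on (F : fieldType) n (P : {set 'I_n}) (S : 'M[F]_n) : Prop :=
  (forall p q, p \in P -> q \in P -> S p q = (p == q)%:R) /\
  (forall p (j : 'I_n), p \in P -> (j < p)%N -> S p j = 0).

Definition leads (F : fieldType) n (v : 'rV[F]_n) (p : 'I_n) : bool :=
  (v 0 p != 0) && [forall j : 'I_n, (j < p)%N ==> (v 0 j == 0)].

Lemma leads_exists (F : fieldType) n (v : 'rV[F]_n) :
  v != 0 -> exists p, leads v p.
Proof.
move=> /rV0Pn [q vq]; case: (arg_minnP (fun i : 'I_n => i : nat) (P := fun j => v 0 j != 0) vq) => p vp pmin.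
exists p; rewrite /leads vp; apply/forallP => j; apply/implyP => jp.
by apply/negPn/negP => /pmin; rewrite leqNgt jp.
Qed.

(** The pivot set [P] consists of the leading positions of the vectors in the row space, so a vector
    of the row space that vanishes on [P] is 0. *)
Lemma reduced_exists (F : finFieldType) m n (M : 'M[F]_(m, n)) :
  exists (P : {set 'I_n}) (S : 'M[F]_n), reduced_on P S /\
    forall v : 'cV[F]_n, M *m v = 0 <-> forall p, p \in P -> row p S *m v = 0.
Proof.
pose P := [set p | [exists v : 'rV[F]_n, (v <= M)%MS && leads v p]].
have zero_on_P (v : 'rV[F]_n) :
    (v <= M)%MS -> (forall p, p \in P -> v 0 p = 0) -> v = 0.
  move=> vM v0; apply: contraTeq isT => /leads_exists [p lp].
  have /v0 vp : p \in P by rewrite inE; apply/existsP; exists v; rewrite vM.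
  by move: lp; rewrite /leads vp eqxx.
have unit_vec (p : 'I_n) : exists v : 'rV[F]_n, p \in P ->
    (v <= M)%MS /\ (forall q, q \in P -> v 0 q = (p == q)%:R).
  (* Downward induction on [p]: in a vector leading at [p], the entries at later pivots are cleared
     with the unit vectors already built. *)
  have [d] := ubnP (n - p)%N; elim: d p => // d IH p lt_d.
  have [pP|] := boolP (p \in P); last by exists 0.
  have /fin_all_exists [V VP] : forall q : 'I_n, exists v : 'rV[F]_n,
      q \in P -> (p < q)%N ->
      (v <= M)%MS /\ (forall r, r \in P -> v 0 r = (q == r)%:R).
    move=> q; have [lt_pq|] := boolP (p < q)%N; last by exists 0.
    have [|v vP] := IH q; last by exists v => qP _; apply: vP.
      by rewrite -ltnS (leq_trans _ lt_d) // ltnS ltn_sub2l // ltn_ord.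
  have := pP; rewrite inE => /existsP [w /andP [wM /andP [wp /forallP w0]]].
  exists ((w 0 p)^-1 *: (w - \sum_(q | (q \in P) && (p < q)%N) w 0 q *: V q)).
  move=> _; split.
    rewrite scalemx_sub // addmx_sub // eqmx_opp summx_sub // => q /andP [qP pq].
    by rewrite scalemx_sub //; case: (VP q qP pq).
  move=> r rP; rewrite !mxE summxE.
  have -> : \sum_(q | (q \in P) && (p < q)%N) (w 0 q *: V q) 0 r =
            if (p < r)%N then w 0 r else 0.
    rewrite (eq_bigr (fun q => if q == r then w 0 r else 0)); last first.
      move=> q /andP [qP pq]; rewrite mxE (VP q qP pq).2 //.
      by case: eqP => [->|_]; rewrite ?mulr1 ?mulr0.
    rewrite -big_mkcondr /=; case: ifP => pr.
      rewrite (big_pred1 r) // => q /=; case: eqP => [->|_]; rewrite ?andbF //.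
      by rewrite rP pr.
    by rewrite big_pred0 // => q; case: eqP => [->|_]; rewrite ?andbF // pr andbF.
  case: (ltngtP p r) => [pr|rp|/val_inj <-].
  - by rewrite subrr mulr0; case: eqP pr => // ->; rewrite ltnn.
  - have /implyP/(_ rp)/eqP -> := w0 r; rewrite subr0 mulr0.
    by case: eqP rp => // ->; rewrite ltnn.
  - by rewrite subr0 mulVf // eqxx.
have [V VP] := fin_all_exists unit_vec.
exists P, (\matrix_p V p); split; first split.
- by move=> p q pP qP; rewrite mxE (VP p pP).2.
(* The leading position of [V p] belongs to [P], and on [P] the only nonzero entry of [V p] is at
   [p]; hence it leads at [p]. *)
- move=> p j pP jp; rewrite mxE; apply: contraTeq isT => Vj.
  have V0 : V p != 0 by apply: contraNneq Vj => ->; rewrite mxE.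
  have [q lq] := leads_exists V0.
  have qP : q \in P by rewrite inE; apply/existsP; exists (V p); rewrite (VP p pP).1.
  have /andP [Vq /forallP/(_ j)] := lq; move: Vq.
  rewrite (VP p pP).2 //; have [<- _|_] := eqVneq p q; last by rewrite eqxx.
  by rewrite jp (negbTE Vj).
- move=> v; split=> [Mv p pP|Sv].
    rewrite rowK; have [/submxP [u ->] _] := VP p pP.
    by rewrite -mulmxA Mv mulmx0.
  apply/row_matrixP => i; rewrite row_mul row0.
  have -> : row i M = \sum_(p in P) M i p *: V p.
    apply/eqP; rewrite -subr_eq0; apply/eqP; apply: zero_on_P.
      rewrite addmx_sub ?row_sub // eqmx_opp summx_sub // => p pP.
      by rewrite scalemx_sub //; case: (VP p pP).
    move=> p pP; rewrite !mxE summxE (bigD1 p) //= big1 ?addr0.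
      by rewrite mxE (VP p pP).2 // eqxx mulr1 subrr.
    move=> q /andP [qP qp]; rewrite mxE (VP q qP).2 //.
    by rewrite (negbTE qp) mulr0.
  rewrite mulmx_suml big1 // => p pP.
  by rewrite -scalemxAl -[V p](rowK V) Sv ?scaler0.
Qed.

(** The selected columns include the pivots of all selected rows, so row [i] still leads in the
    column that [g] sends to [f i]. *)
Lemma rref_mxsub (F : fieldType) n (P : {set 'I_n}) (S : 'M[F]_n) k l
    (f : 'I_k -> 'I_n) (g : 'I_l -> 'I_n) :
    reduced_on P S -> increasing f -> (forall i, f i \in P) ->
    increasing g -> (forall i, exists j, g j = f i) ->
  rref (mxsub f g S).
Proof.
move=> [S1 S0] fS fP gS fg.
have lead i j : mxsub f g S i j != 0 /\
    (forall j' : 'I_l, (j' < j)%N -> mxsub f g S i j' = 0) -> g j = f i.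
  rewrite mxE => -[nz z]; have [j0 gj0] := fg i; rewrite -gj0.
  congr g; apply: val_inj; apply/eqP; case: ltngtP => // lt.
    by move: nz; rewrite S0 ?eqxx // -gj0 gS.
  by have := z _ lt; rewrite mxE gj0 S1 // eqxx => /eqP; rewrite oner_eq0.
split.
- move=> i i' _ /rowP; have [j gj] := fg i => /(_ j).
  by rewrite !mxE gj S1 // eqxx => /eqP; rewrite oner_eq0.
- move=> i i' j j' /fS lt /lead e /lead e'.
  by rewrite -(increasing_mono gS) e e'.
- by move=> i j /lead e; rewrite mxE e S1 // eqxx.
- move=> i i' j /lead e ne; rewrite mxE e S1 //.
  by rewrite (inj_eq (increasing_inj fS)) (negbTE ne).
Qed.

(** Reduced row echelon form without zero rows, the pivot columns being named by [f]. *)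
Definition echelon (F : fieldType) k n (A : 'M[F]_(k, n)) (f : 'I_k -> 'I_n) : Prop :=
  [/\ increasing f, forall i i', A i (f i') = (i == i')%:R &
      forall i (j : 'I_n), (j < f i)%N -> A i j = 0].

Lemma rref_echelon (F : fieldType) k n (A : 'M[F]_(k, n)) :
  rref A -> (forall i, row i A != 0) -> exists f, echelon A f.
Proof.
move=> [_ inc one zero] nz.
have /fin_all_exists [f fP] : forall i, exists j, leads (row i A) j.
  by move=> i; apply: leads_exists.
have lead i : A i (f i) != 0 /\ (forall j : 'I_n, (j < f i)%N -> A i j = 0).
  have /andP [nzi /forallP z] := fP i; rewrite mxE in nzi; split=> // j lt.
  by have /implyP/(_ lt)/eqP := z j; rewrite mxE.
exists f; split.
- by move=> i i' lt; apply: (inc i i').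
- move=> i i'; have [->|ne] := eqVneq i i'; first exact: one.
  by apply: zero (lead i') ne.
- by move=> i j; apply: (lead i).2.
Qed.

(* Solves the system [A *m v = 0] with the free variable [j] set to 1. *)
Definition free_solution (F : fieldType) k n (A : 'M[F]_(k, n)) (f : 'I_k -> 'I_n)
    (j : 'I_n) : 'cV[F]_n :=
  delta_mx j 0 - \sum_i A i j *: delta_mx (f i) 0.

Lemma mulmx_delta_col (F : fieldType) k n (A : 'M[F]_(k, n)) (j : 'I_n) :
  A *m (delta_mx j 0 : 'cV[F]_n) = col j A.
Proof. by rewrite colE. Qed.

Lemma free_solution_ker (F : fieldType) k n (A : 'M[F]_(k, n)) f j :
  echelon A f -> A *m free_solution A f j = 0.
Proof.
move=> [_ A1 _]; rewrite mulmxBr mulmx_sumr mulmx_delta_col.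
apply/colP => i; rewrite !mxE summxE (bigD1 i) //= big1 ?addr0.
  by rewrite -scalemxAr mulmx_delta_col !mxE A1 eqxx mulr1 subrr.
move=> i' ne; rewrite -scalemxAr mulmx_delta_col !mxE A1.
by rewrite eq_sym (negbTE ne) mulr0.
Qed.

(** This describes the pivots by the kernel alone. The equation of a pivot row expresses [v j]
    through later entries. At a free column [j], [free_solution] has entry 1 at [j] and vanishes
    afterwards, since [A i j = 0] whenever [j < f i]. *)
Lemma echelon_pivotE (F : fieldType) k n (A : 'M[F]_(k, n)) f j : echelon A f ->
  (j \in codom f) <-> (forall v : 'cV[F]_n, A *m v = 0 ->
     (forall j' : 'I_n, (j < j')%N -> v j' 0 = 0) -> v j 0 = 0).
Proof.
move=> eA; have [fS A1 A0] := eA; split.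
  move=> /codomP [i ->] v /colP/(_ i); rewrite !mxE (bigD1 (f i)) //= A1 eqxx mul1r.
  move=> + v0; rewrite big1 ?addr0 // => j' ne.
  have [lt|lt|e] := ltngtP (f i) j'; first by rewrite v0 // mulr0.
    by rewrite A0 ?mul0r.
  by move: ne; rewrite (val_inj e) eqxx.
move=> H; apply/negPn/negP => jN.
have := H _ (free_solution_ker j eA).
have ev j' : free_solution A f j j' 0 = (j' == j)%:R - \sum_i A i j * (j' == f i)%:R.
  rewrite !mxE eqxx andbT summxE; congr (_ - _); apply: eq_bigr => i _.
  by rewrite !mxE eqxx andbT.
rewrite ev eqxx big1; last first.
  move=> i _; case: eqP => [e|_]; last by rewrite mulr0.
  by move: jN; rewrite e codom_f.
rewrite subr0 mulr1n => H1; suff /H1/eqP : forall j' : 'I_n, (j < j')%N ->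
    free_solution A f j j' 0 = 0 by rewrite oner_eq0.
move=> j' lt.
rewrite ev big1 => [|i _]; first by case: eqP lt => [->|_]; rewrite ?ltnn ?subr0.
by case: eqP => [e|_]; rewrite ?mulr0 // A0 ?mul0r // -e.
Qed.

Lemma echelon_unique (F : fieldType) k k' n (A : 'M[F]_(k, n)) (A' : 'M[F]_(k', n))
    f f' :
    echelon A f -> echelon A' f' ->
    (forall v : 'cV[F]_n, A *m v = 0 <-> A' *m v = 0) ->
  [/\ k = k', codom f =i codom f',
      forall (i : 'I_k) (i' : 'I_k'), i = i' :> nat -> f i = f' i' &
      forall i i', f i = f' i' -> row i A = row i' A'].
Proof.
move=> eA eA' ker.
have eq_im : codom f =i codom f'.
  move=> j; apply/idP/idP.
    by move/(echelon_pivotE _ eA) => H; apply/(echelon_pivotE _ eA') => v /ker; apply: H.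
  by move/(echelon_pivotE _ eA') => H; apply/(echelon_pivotE _ eA) => v /ker; apply: H.
have [fS A1 _] := eA; have [f'S A'1 _] := eA'.
have [eqk eqf] := increasing_same_image fS f'S eq_im.
split=> // i i' fi; apply/rowP => j; rewrite !mxE.
have fii' i1 i2 : f i1 = f' i2 -> i1 = i2 :> nat.
  move=> e; have lt : (i1 < k')%N by rewrite -eqk.
  by rewrite (_ : i2 = Ordinal lt) //; apply: (increasing_inj f'S); rewrite -e; apply: eqf.
(* The free solution of [A] at [j] is also annihilated by [A'], and row [i'] of this equation reads
   [A' i' j = A i j]. *)
have := free_solution_ker j eA => /ker /colP/(_ i').
rewrite mulmxBr mulmx_sumr mulmx_delta_col !mxE summxE (bigD1 i) //= big1.
  rewrite addr0 -scalemxAr mxE mulmx_delta_col mxE fi A'1 eqxx mulr1.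
  by move=> /eqP; rewrite subr_eq0 => /eqP.
move=> i1 ne; rewrite -scalemxAr mxE mulmx_delta_col mxE.
have lt : (i1 < k')%N by rewrite -eqk.
rewrite (eqf i1 (Ordinal lt)) // A'1; case: eqP => [e|_]; last by rewrite mulr0.
case/eqP: ne; apply: val_inj; rewrite /= (fii' _ _ fi) e //.
Qed.

(** * Bit strings as vectors over ['F_2], and phase-free spiders *)

Definition bvec n (y : bits n) : 'cV['F_2]_n := \col_q (y q)%:R.
Definition vecb n (v : 'cV['F_2]_n) : bits n := [ffun q => v q 0 != 0].

Lemma F2_natb (x : 'F_2) : x = (x != 0)%:R.
Proof. by case: x => [[|[|m]] //] lt; apply: val_inj. Qed.

Lemma F2_natr_eq0 m : ((m%:R : 'F_2) == 0) = ~~ odd m.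
Proof. by rewrite -(dvdn_pcharf (pchar_Fp (isT : prime 2))) dvdn2. Qed.

Lemma F2_natb_eq0 (b : bool) : ((b%:R : 'F_2) == 0) = ~~ b.
Proof. by case: b. Qed.

Lemma F2_oppr (x : 'F_2) : - x = x.
Proof. exact: oppr_pchar2 (pchar_Fp (isT : prime 2)) x. Qed.

Lemma bvecK n : cancel (@bvec n) (@vecb n).
Proof. by move=> y; apply/ffunP => q; rewrite ffunE mxE F2_natb_eq0 negbK. Qed.

Lemma vecbK n : cancel (@vecb n) (@bvec n).
Proof. by move=> v; apply/colP => q; rewrite mxE ffunE -F2_natb. Qed.


Lemma prodr_natb (T : comPzSemiRingType) (I : finType) (b : pred I) :
  \prod_i ((b i)%:R : T) = [forall i, b i]%:R.
Proof.
have [/existsP [i /negbTE bi]|/existsPn H] := boolP [exists i, ~~ b i].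
  rewrite (_ : [forall i, b i] = false); last by apply/forallP => /(_ i); rewrite bi.
  by rewrite (bigD1 i) //= bi mul0r.
rewrite big1 => [|i _]; last by rewrite (negPn (H i)).
by rewrite (_ : [forall i, b i]) //; apply/forallP => i; apply/negPn.
Qed.

Lemma spider_Z (R : realType) b (s : seq bool) :
  node_tensor ZColor (0 : R) (b :: s) = (all (eq_op b) s)%:R.
Proof.
rewrite /= /spider /expi cos0 sin0 mul1r !big_cons.
have -> : \prod_(c <- s) ket0 c = (all negb s)%:R :> R[i].
  by elim: s => [|c s IH]; rewrite ?big_nil // big_cons IH /ket0 -natrM mulnb.
have -> : \prod_(c <- s) ket1 c = (all id s)%:R :> R[i].
  by elim: s => [|c s IH]; rewrite ?big_nil // big_cons IH /ket1 -natrM mulnb.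
case: b; rewrite /ket0 /ket1 mul0r mul1r ?add0r ?addr0.
  by congr (_%:R); congr nat_of_bool; apply: eq_all => -[].
by congr (_%:R); congr nat_of_bool; apply: eq_all => -[].
Qed.

(** The product of the [ketm] is that of the [ketp] times the sign given by the parity of [s], so
    the two terms double or cancel. *)
Lemma spider_X (R : realType) (s : seq bool) :
  node_tensor XColor (0 : R) s =
  (sqrtC 2)^-1 ^+ size s * 2 * ((\sum_(b <- s) (b%:R : 'F_2)) == 0)%:R.
Proof.
rewrite /= /spider /expi cos0 sin0 mul1r.
have -> : \prod_(b <- s) ketp b = (sqrtC 2)^-1 ^+ size s :> R[i].
  by elim: s => [|c s IH]; rewrite ?big_nil // big_cons IH exprS.
have -> : \prod_(b <- s) ketm b =
    (-1) ^+ (\sum_(b <- s) (b : nat))%N * (sqrtC 2)^-1 ^+ size s :> R[i].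
  elim: s => [|c s IH]; first by rewrite !big_nil mul1r.
  by rewrite !big_cons IH /ketm exprD exprS mulrACA.
rewrite -natr_sum F2_natr_eq0 -signr_odd; case: odd => /=.
  by rewrite mulN1r subrr mulr0.
by rewrite mul1r mulr1 mulr_natr mulr2n.
Qed.

(** * The linear map of a phase-free bipartite diagram *)

(** Unlike [input_Z_mx], it keeps all [n] columns and so acts on the same vectors as [outputX_mx];
    the bipartite rule makes the additional columns zero. *)
Definition in_mx (R : realType) n (D : diagram R n) : 'M['F_2]_(nin D, n) :=
  \matrix_(i, o) (@adj R n D (inl i) (inr o))%:R.

Section PhaseFree.
Context {R : realType} {n : nat} (D : diagram R n).
Hypotheses (Dform : encoder_respecting D) (Dbip : bipartite_rule D)
  (Dfree : phase_free_rule D).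

Lemma node_colorE (v : node D) :
  node_color D v = if in_X_group v then XColor else ZColor.
Proof. by case: v => [i|o] /=; [apply: Dbip.1 | case: (node_color D _)]. Qed.

(* On nonzero terms of the contraction the Z outputs copy their free bit to all their edges. *)
Definition Z_bit (y : bits n) (v : node D) : bool :=
  if v is inr o then y o else false.

Definition copy_labelling (y : bits n) : {ffun node D * node D -> bool} :=
  [ffun uv => adj uv.1 uv.2 && Z_bit y (if in_X_group uv.1 then uv.2 else uv.1)].

Lemma copy_labellingP y : edge_labelling (copy_labelling y).
Proof.
have [sym _ _ _ _] := Dform.
apply/forallP => u; apply/forallP => v; rewrite !ffunE /= (sym v u).
have [uv|] := boolP (adj u v); last by rewrite eqxx.
by have := Dbip.2 _ _ uv; rewrite implybT andbT; case: in_X_group; case: in_X_group.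
Qed.

(** All neighbours of a node in the X group are Z outputs, so for such a node this is the parity of
    its legs under [copy_labelling]. *)
Definition node_parity (y : bits n) (x : bits (nin D)) (v : node D) : 'F_2 :=
  (free_bit x y v)%:R + \sum_(o | adj v (inr o)) (y o)%:R.

(** The factor from [spider_X]; the successor in the exponent counts the free leg. *)
Definition node_scalar (v : node D) : R[i] :=
  if in_X_group v then
    (sqrtC 2)^-1 ^+ (size [seq u <- enum {: node D} | adj v u]).+1 * 2
  else 1.

Lemma node_scalar_neq0 v : node_scalar v != 0.
Proof.
rewrite /node_scalar; case: ifP => _; last exact: oner_neq0.
by rewrite mulf_neq0 ?pnatr_eq0 // expf_neq0 // invr_eq0 sqrtC_eq0 pnatr_eq0.
Qed.

Lemma contraction_copy y x :
  contraction y x = (\prod_v node_scalar v) *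
    [forall v : node D, in_X_group v ==> (node_parity y x v == 0)]%:R.
Proof.
have [sym _ noin _ _] := Dform.
rewrite /contraction (bigD1 (copy_labelling y)) ?copy_labellingP //=.
(* Any other labelling fails to copy the bit of some Z output, whose spider then vanishes. *)
rewrite [X in _ + X]big1 ?addr0; last first.
  move=> w /andP [/forallP wl ne].
  have [v /andP [vZ]] : exists v : node D, ~~ in_X_group v &&
      ~~ all (eq_op (free_bit x y v)) [seq w (v, u) | u <- enum {: node D} & adj v u].
    apply/existsP; apply: contraNT ne => /existsPn H.
    have wZ u v : ~~ in_X_group u -> adj u v -> w (u, v) = Z_bit y u.
      move=> uZ uv; have := H u; rewrite uZ /= negbK => /allP/(_ (w (u, v))) Hw.
      have /Hw/eqP <- : w (u, v) \in [seq w (u, v') | v' <- enum {: node D} & adj u v'].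
        by apply: (map_f (fun v' => w (u, v'))); rewrite mem_filter uv mem_enum.
      by case: u uZ {uv H Hw}.
    apply/eqP/ffunP => -[u v]; rewrite ffunE /=.
    have /forallP/(_ v)/andP [/eqP w_sym /implyP w_adj] := wl u.
    have [uv|/negP nuv] := boolP (adj u v); last by apply/negP => /w_adj.
    have := Dbip.2 _ _ uv; case: ifP => [_|/negbT uX _]; last exact: wZ.
    by rewrite w_sym => vZ; apply: wZ; rewrite // sym.
  move=> nall; rewrite (bigD1 v) //= node_colorE (negbTE vZ) Dfree.1 spider_Z.
  by rewrite (negbTE nall) mul0r.
rewrite -prodr_natb -big_split /=; apply: eq_bigr => v _.
rewrite node_colorE Dfree.1 /node_scalar; case: ifP => vX.
  rewrite spider_X /= size_map big_cons big_map big_filter big_enum_cond /=.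
  congr (_ * (_ == 0)%:R); rewrite /node_parity; congr (_ + _).
  rewrite big_sumType /= big1 ?add0r => [|i _]; last first.
    by rewrite ffunE /= vX /= andbF.
  by apply: eq_bigr => o vo; rewrite ffunE /= vo vX.
rewrite spider_Z mul1r implyFb; congr (nat_of_bool _)%:R.
apply/allP => b /mapP [u]; rewrite mem_filter => /andP [vu _] ->.
by rewrite ffunE /= vu vX; case: v vX {vu}.
Qed.

Definition map_scalar : R[i] := \prod_(v : node D) node_scalar v.

Lemma map_scalar_neq0 : map_scalar != 0.
Proof. by apply/prodf_neq0 => v _; apply: node_scalar_neq0. Qed.

(** The parity at an input node is a row of [x = A y], that at an X output a row of [H y = 0]; the
    diagonal mark in [outputX_mx] accounts for the free edge of the X output itself. *)
Lemma contractionE y x : contraction y x = map_scalar *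
  ((bvec x == in_mx D *m bvec y) && (outputX_mx D *m bvec y == 0))%:R.
Proof.
have [sym irr noin _ _] := Dform.
rewrite contraction_copy; congr (_ * (nat_of_bool _)%:R).
have inE' i : node_parity y x (inl i) = bvec x i 0 - (in_mx D *m bvec y) i 0.
  rewrite F2_oppr /node_parity !mxE /=; congr (_ + _).
  rewrite [LHS]big_mkcond; apply: eq_bigr => o _; rewrite !mxE.
  by case: ifP; rewrite ?mul1r ?mul0r.
have outE i : node_parity y x (inr (enum_val i)) = (outputX_mx D *m bvec y) i 0.
  rewrite /node_parity !mxE /= [RHS](bigD1 (enum_val i)) //= !mxE eqxx mul1r.
  congr (_ + _); rewrite [LHS]big_mkcond [RHS]big_mkcond /=; apply: eq_bigr => o _.
  rewrite !mxE; have [<-|ne] := eqVneq o (enum_val i); first by rewrite (negbTE (irr _)).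
  by rewrite /=; case: ifP; rewrite ?mul1r ?mul0r.
apply/forallP/andP => [H|[/eqP Hx /eqP Hy] [i|o]].
  split; apply/eqP/colP => i.
    by have := H (inl i); rewrite /= inE' subr_eq0 => /eqP.
  have := H (inr (enum_val i)); rewrite outE => /implyP oX.
  by rewrite (eqP (oX _)) ?mxE //; have := enum_valP i; rewrite inE.
  by rewrite /= inE' Hx subrr.
apply/implyP => oX; have oX' : o \in X_outputs D by rewrite inE.
by rewrite -(enum_rankK_in oX' oX') outE Hy mxE.
Qed.

End PhaseFree.

(** * Tensor products of single-qubit operators *)

Lemma map_of_kernelE (R : realType) m n (K : bits m -> bits n -> R[i])
    (psi : qstate R n) y :
  map_of_kernel K psi y = \sum_x K y x * psi x.
Proof. by rewrite lfunE /= ffunE. Qed.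

Lemma bit_ord_inj : injective bit_ord.
Proof. by case=> -[] // /(congr1 val); rewrite /= !inordK. Qed.

(** Each factor has at most one nonzero entry per row, so a single basis vector contributes to each
    amplitude. The identity and the Pauli letters of CSS generators have this form. *)
Lemma tensor_op_monomial (R : realType) n (U : 'I_n -> 'M[R[i]]_2)
    (a : 'I_n -> bool) (s : 'I_n -> bool -> R[i]) :
    (forall q r c, U q (bit_ord r) (bit_ord c) = (c == r (+) a q)%:R * s q r) ->
  forall psi y, tensor_op U psi y =
    (\prod_q s q (y q)) * psi [ffun q => y q (+) a q].
Proof.
move=> UE psi y; rewrite map_of_kernelE (bigD1 [ffun q => y q (+) a q]) //=.
rewrite [X in _ + X]big1 ?addr0; last first.
  move=> x ne; have [q nq] : exists q, x q != y q (+) a q.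
    apply/existsP; apply: contraNT ne => /existsPn H.
    by apply/eqP/ffunP => q; rewrite ffunE; apply/eqP/negPn/H.
  by rewrite (bigD1 q) //= UE (negbTE nq) !mul0r.
by congr (_ * _); apply: eq_bigr => q _; rewrite UE ffunE eqxx mul1r.
Qed.

Lemma tensor_op1 (R : realType) n (U : 'I_n -> 'M[R[i]]_2) :
  (forall q, U q = 1%:M) -> tensor_op U = \1%VF.
Proof.
move=> U1; apply/lfunP => psi; rewrite id_lfunE; apply/ffunP => y.
rewrite (@tensor_op_monomial _ _ _ (fun=> false) (fun _ _ => 1)) => [|q r c].
  rewrite big1 // mul1r; congr (psi _); apply/ffunP => q.
  by rewrite ffunE addbF.
by rewrite U1 mxE (inj_eq bit_ord_inj) addbF mulr1 eq_sym.
Qed.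

(** * Injectivity and image of the encoder *)

Section Encoder.
Context {R : realType} {n : nat} (D : diagram R n).
Hypotheses (Dform : encoder_respecting D) (Dbip : bipartite_rule D)
  (Dfree : phase_free_rule D).

Lemma diagram_mapE phi y : diagram_map D phi y =
  map_scalar D * ((outputX_mx D *m bvec y == 0)%:R * phi (vecb (in_mx D *m bvec y))).
Proof.
rewrite /diagram_map (tensor_op1 Dfree.2) comp_lfun1l map_of_kernelE.
rewrite (bigD1 (vecb (in_mx D *m bvec y))) //= [X in _ + X]big1 ?addr0; last first.
  move=> x ne; rewrite (contractionE Dform Dbip Dfree).
  have -> : (bvec x == in_mx D *m bvec y) = false.
    by apply: contraNF ne => /eqP <-; rewrite bvecK.
  by rewrite mulr0 mul0r.
by rewrite (contractionE Dform Dbip Dfree) vecbK eqxx /= mulrA.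
Qed.

(** The value of [phi] at an attained [x] can be read off its image, whereas the basis state at a
    point that is not attained is mapped to 0. *)
Lemma injective_encoderP : injective_encoder D <->
  forall x, exists v : 'cV['F_2]_n, outputX_mx D *m v = 0 /\ in_mx D *m v = x.
Proof.
split=> [inj x|surj]; last first.
  apply/eqP; rewrite -subv0; apply/subvP => phi; rewrite memv_ker memv0 => /eqP D0.
  apply/eqP/ffunP => x; rewrite ffunE; have [v [Hv xv]] := surj (bvec x).
  have := congr1 (fun psi : qstate R n => psi (vecb v)) D0.
  rewrite diagram_mapE vecbK Hv xv bvecK eqxx mul1r ffunE => /eqP.
  by rewrite mulf_eq0 (negbTE (map_scalar_neq0 D)) => /eqP.
have [/existsP [v /andP [/eqP Hv /eqP xv]]|/existsPn no] :=
  boolP [exists v : 'cV['F_2]_n, (outputX_mx D *m v == 0) && (in_mx D *m v == x)]; first by exists v.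
pose phi : qstate R (nin D) := [ffun z => (z == vecb x)%:R].
have : phi \in lker (diagram_map D).
  rewrite memv_ker; apply/eqP/ffunP => y; rewrite diagram_mapE !ffunE.
  rewrite (inj_eq (can_inj (@vecbK _))) -natrM mulnb.
  by rewrite (negbTE (no (bvec y))) mulr0.
rewrite inj memv0 => /eqP/ffunP/(_ (vecb x)); rewrite !ffunE eqxx => /eqP.
by rewrite oner_eq0.
Qed.

Definition codespace_mem (psi : qstate R n) : Prop :=
  (forall v : 'cV['F_2]_n, outputX_mx D *m v != 0 -> psi (vecb v) = 0) /\
  (forall v v' : 'cV['F_2]_n, outputX_mx D *m v = 0 -> outputX_mx D *m v' = 0 ->
     in_mx D *m v = in_mx D *m v' -> psi (vecb v) = psi (vecb v')).

Lemma mem_limg_diagram psi : injective_encoder D ->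
  psi \in limg (diagram_map D) <-> codespace_mem psi.
Proof.
move=> /injective_encoderP surj; split.
  move=> /memv_imgP [phi _ ->]; split=> [v /negbTE Hv|v v' Hv Hv' e].
    by rewrite diagram_mapE vecbK Hv mul0r mulr0.
  by rewrite !diagram_mapE !vecbK Hv Hv' e.
move=> [supp const].
(* A section [s] of [A] with values in [ker H] turns [psi] into a preimage, up to the scalar. *)
have /fin_all_exists [s sP] := surj.
pose phi : qstate R (nin D) := [ffun x => (map_scalar D)^-1 * psi (vecb (s (bvec x)))].
apply/memv_imgP; exists phi; rewrite ?memvf //; apply/ffunP => y.
rewrite diagram_mapE ffunE vecbK mulrCA mulVKf ?map_scalar_neq0 //.
have [Hy|Hy] := eqVneq (outputX_mx D *m bvec y) 0; last first.
  by rewrite mul0r -[y]bvecK supp.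
rewrite mul1r -{1}[y]bvecK; apply: const => //; first by case: (sP (in_mx D *m bvec y)).
by have [_ ->] := sP (in_mx D *m bvec y).
Qed.

(** [ker H] is the union of the supports of the states in the image; its own indicator function is
    one of them. *)
Lemma outputX_kerP (v : 'cV['F_2]_n) : injective_encoder D ->
  outputX_mx D *m v = 0 <->
  exists psi, psi \in limg (diagram_map D) /\ psi (vecb v) != 0.
Proof.
move=> inj; split=> [Hv|[psi [/(mem_limg_diagram _ inj) [supp _]]]].
  pose psi : qstate R n := [ffun y => (outputX_mx D *m bvec y == 0)%:R].
  exists psi; split; last by rewrite ffunE vecbK Hv eqxx oner_neq0.
  apply/(mem_limg_diagram _ inj); split=> [w /negbTE Hw|w w' Hw Hw' _].
    by rewrite ffunE vecbK Hw.
  by rewrite !ffunE !vecbK Hw Hw'.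
by move=> nz; apply/eqP/negPn; apply: contra nz => /supp ->.
Qed.

(** The indicator function of [K] lies in the image and separates 0 from every point outside [K]. *)
Lemma in_kerP (v : 'cV['F_2]_n) : injective_encoder D ->
  (outputX_mx D *m v = 0 /\ in_mx D *m v = 0) <->
  (forall psi, psi \in limg (diagram_map D) -> psi (vecb v) = psi (vecb 0)).
Proof.
move=> inj; split=> [[Hv Av] psi /(mem_limg_diagram _ inj) [_ const]|H].
  by apply: const; rewrite ?mulmx0.
pose psi : qstate R n :=
  [ffun y => ((outputX_mx D *m bvec y == 0) && (in_mx D *m bvec y == 0))%:R].
have /H : psi \in limg (diagram_map D).
  apply/(mem_limg_diagram _ inj); split=> [w /negbTE Hw|w w' Hw Hw' e].
    by rewrite ffunE vecbK Hw.
  by rewrite !ffunE !vecbK Hw Hw' e.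
rewrite !ffunE !vecbK !mulmx0 !eqxx /=.
case: (_ =P _) => [->|_]; last by move/eqP; rewrite eq_sym oner_eq0.
by case: (_ =P _) => [->|_] //; move/eqP; rewrite eq_sym oner_eq0.
Qed.

End Encoder.

(** * Uniqueness *)

(** A change at the pivot [f i] affects equation [i] only, so the pivot entries can be corrected one
    by one. *)
Lemma echelon_solution (F : fieldType) k n (A : 'M[F]_(k, n)) f (v : 'cV[F]_n) :
  echelon A f -> exists c : 'cV[F]_n,
    A *m c = 0 /\ forall j, j \notin codom f -> c j 0 = v j 0.
Proof.
move=> [fS A1 _]; exists (v - \sum_i (A *m v) i 0 *: delta_mx (f i) 0); split.
  rewrite mulmxBr mulmx_sumr; apply/colP => i; move: (A *m v) => w.
  rewrite !mxE summxE (bigD1 i) //= big1 ?addr0 => [|i' ne].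
    by rewrite -scalemxAr mulmx_delta_col !mxE A1 eqxx mulr1 subrr.
  by rewrite -scalemxAr mulmx_delta_col !mxE A1 eq_sym (negbTE ne) mulr0.
move=> j jf; rewrite !mxE summxE big1 ?subr0 // => i _.
rewrite !mxE; case: eqP => [e|_]; last by rewrite mulr0.
by move: jf; rewrite e codom_f.
Qed.

Section CanonicalDiagram.
Context {R : realType} {n : nat} (D : diagram R n).
Hypotheses (Dform : encoder_respecting D) (Dinj : injective_encoder D)
  (Dbip : bipartite_rule D) (Dfree : phase_free_rule D) (Drref : rref_rule D).

(** X outputs are not adjacent to each other, and the order clause of [rref_rule] puts their Z
    neighbours later, so each row leads at its own node. *)
Lemma outputX_echelon :
  echelon (outputX_mx D) (fun i : 'I_#|X_outputs D| => enum_val i).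
Proof.
have [_ _ order] := Drref; split; first exact: increasing_enum_val.
  move=> i i'; rewrite !mxE (inj_eq enum_val_inj); case: eqP => //= _.
  case: (boolP (adj _ _)) => // /Dbip.2 /=.
  by have := enum_valP i; have := enum_valP i'; rewrite !inE => -> ->.
move=> i j lt; rewrite !mxE; case: eqP => [e|_] /=; first by rewrite e ltnn in lt.
case: (boolP (adj _ _)) => // ij.
have jZ : j \in Z_outputs D.
  have := Dbip.2 _ _ ij; rewrite !inE /=.
  by have := enum_valP i; rewrite inE => ->; case: is_X.
by have := order _ _ (enum_valP i) jZ ij; rewrite ltnNge (ltnW lt).
Qed.

Lemma in_mx_X i o : o \in X_outputs D -> in_mx D i o = 0.
Proof.
rewrite inE mxE => oX; case: (boolP (adj _ _)) => // /Dbip.2 /=.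
by rewrite oX.
Qed.

(** Injectivity excludes zero rows, and reinserting the zero columns of the X outputs preserves the
    echelon form. *)
Lemma in_mx_echelon : exists f, echelon (in_mx D) f.
Proof.
have [rr _ _] := Drref.
have [|f0 [f0S A1 A0]] := rref_echelon rr.
  move=> i; apply/negP => /eqP/rowP z.
  have [v [_ /colP/(_ i)]] := (injective_encoderP Dform Dbip Dfree).1 Dinj (delta_mx i 0).
  rewrite !mxE !eqxx big1 => [/eqP|o _]; first by rewrite eq_sym oner_eq0.
  have [oZ|] := boolP (o \in Z_outputs D); last first.
    by rewrite inE negbK => /in_mx_X ->; rewrite mul0r.
  have := z (enum_rank_in oZ o); rewrite !mxE enum_rankK_in // => ->.
  by rewrite mul0r.
exists (fun i => enum_val (f0 i)); split.
- by move=> i i' lt; apply: increasing_enum_val; apply: f0S.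
- by move=> i i'; rewrite -A1 !mxE.
- move=> i o lt; have [oZ|] := boolP (o \in Z_outputs D); last first.
    by rewrite inE negbK => /in_mx_X ->.
  rewrite -(A0 i (enum_rank_in oZ o)) ?mxE ?enum_rankK_in //.
  by rewrite -(increasing_mono (@increasing_enum_val _ _)) enum_rankK_in.
Qed.

Lemma codom_enum_val (T : finType) (A : {set T}) x :
  (x \in codom (fun i : 'I_#|A| => enum_val i)) = (x \in A).
Proof.
apply/codomP/idP => [[i ->]|xA]; first exact: enum_valP.
by exists (enum_rank_in xA x); rewrite enum_rankK_in.
Qed.

Lemma in_mx_eq (c v : 'cV['F_2]_n) :
  (forall o, o \notin X_outputs D -> c o 0 = v o 0) -> in_mx D *m c = in_mx D *m v.
Proof.
move=> cv; apply/colP => i; rewrite !mxE; apply: eq_bigr => o _.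
have [oX|/cv -> //] := boolP (o \in X_outputs D).
by rewrite in_mx_X // !mul0r.
Qed.

(* Prescribes the Z output bits and solves for the X output bits. *)
Lemma outputX_solution (v : 'cV['F_2]_n) : exists c : 'cV['F_2]_n,
  outputX_mx D *m c = 0 /\ forall o, o \notin X_outputs D -> c o 0 = v o 0.
Proof.
have [c [Hc cv]] := echelon_solution v outputX_echelon.
by exists c; split=> // o oX; apply: cv; rewrite codom_enum_val.
Qed.

(** [A] does not see the bits of the X outputs, and these can be chosen so that [H] vanishes. Hence
    [K] and the set of X outputs determine [ker A]. *)
Lemma in_mx_kerP (v : 'cV['F_2]_n) :
  in_mx D *m v = 0 <-> exists c : 'cV['F_2]_n,
    (outputX_mx D *m c = 0 /\ in_mx D *m c = 0) /\
    forall o, o \notin X_outputs D -> c o 0 = v o 0.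
Proof.
split=> [v0|[c [[_ c0] /in_mx_eq <-]] //].
have [c [Hc cv]] := outputX_solution v.
by exists c; split=> //; split=> //; rewrite (in_mx_eq cv).
Qed.

End CanonicalDiagram.

Lemma diagram_ext (R : realType) n (D D' : diagram R n) :
    encoder_respecting D -> encoder_respecting D' ->
    bipartite_rule D -> bipartite_rule D' ->
    phase_free_rule D -> phase_free_rule D' ->
    nin D = nin D' ->
    (forall o, node_color D (inr o) = node_color D' (inr o)) ->
    (forall (i : 'I_(nin D)) (i' : 'I_(nin D')) o, i = i' :> nat ->
       @adj _ _ D (inl i) (inr o) = @adj _ _ D' (inl i') (inr o)) ->
    (forall o o', @adj _ _ D (inr o) (inr o') = @adj _ _ D' (inr o) (inr o')) ->
  D = D'.
Proof.
case: D D' => [k c p e l] [k' c' p' e' l'].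
move=> [sym _ noin _ _] [sym' _ noin' _ _] [col _] [col' _] [ph loc] [ph' loc'].
rewrite /= in col col' ph ph' loc loc' * => eqk; subst k' => eqc eqi eqo.
have -> : c = c'.
  by apply/ffunP => -[i|o]; [rewrite col col' | apply: eqc].
have -> : p = p' by apply/ffunP => u; rewrite ph ph'.
have -> : l = l' by apply/ffunP => o; rewrite loc loc'.
suff -> : e = e' by [].
apply/setP => -[[i|o] [i'|o']].
- by have := noin i i'; have := noin' i i'; rewrite /adj /= => /negbTE -> /negbTE ->.
- exact: eqi.
- by have := sym (inr o) (inl i'); have := sym' (inr o) (inl i');
    rewrite /adj /= => -> ->; apply: eqi.
- exact: eqo.
Qed.

Lemma canonical_diagram_unique (R : realType) n (D D' : diagram R n) :
    encoder_respecting D -> injective_encoder D ->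
    bipartite_rule D -> phase_free_rule D -> rref_rule D ->
    encoder_respecting D' -> injective_encoder D' ->
    bipartite_rule D' -> phase_free_rule D' -> rref_rule D' ->
    limg (diagram_map D) = limg (diagram_map D') ->
  D = D'.
Proof.
move=> form inj bip free rr form' inj' bip' free' rr' eqW.
have kerH (v : 'cV['F_2]_n) : outputX_mx D *m v = 0 <-> outputX_mx D' *m v = 0.
  by rewrite (outputX_kerP form bip free) // (outputX_kerP form' bip' free') // eqW.
have [_ eq_im _ eq_row] :=
  echelon_unique (outputX_echelon bip rr) (outputX_echelon bip' rr') kerH.
have eqX : X_outputs D = X_outputs D'.
  by apply/setP => o; rewrite -!codom_enum_val eq_im.
have kerK (v : 'cV['F_2]_n) : (outputX_mx D *m v = 0 /\ in_mx D *m v = 0) <->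
    (outputX_mx D' *m v = 0 /\ in_mx D' *m v = 0).
  by rewrite (in_kerP form bip free v inj) (in_kerP form' bip' free' v inj') eqW.
have kerA (v : 'cV['F_2]_n) : in_mx D *m v = 0 <-> in_mx D' *m v = 0.
  by rewrite (in_mx_kerP bip rr) (in_mx_kerP bip' rr');
    split=> -[c [/kerK Kc cv]]; exists c; split=> // o oX; apply: cv;
    move: oX; rewrite eqX.
have [f ef] := in_mx_echelon form inj bip free rr.
have [f' ef'] := in_mx_echelon form' inj' bip' free' rr'.
have [eqk _ eqf eq_rowA] := echelon_unique ef ef' kerA.
apply: diagram_ext => //.
- move=> o; move/setP/(_ o): eqX; rewrite !inE.
  by case: (node_color D _); case: (node_color D' _).
- move=> i i' o /eqf /eq_rowA /rowP/(_ o); rewrite !mxE.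
  by case: (adj _ _); case: (adj _ _) => // /eqP; rewrite ?oner_eq0 // eq_sym oner_eq0.
(* The rows of [outputX_mx] give the edges at X outputs, except on the diagonal, where the absence
   of loops decides. *)
have adjX o o' : o \in X_outputs D ->
    @adj _ _ D (inr o) (inr o') = @adj _ _ D' (inr o) (inr o').
  move=> oX; have oX' : o \in X_outputs D' by rewrite -eqX.
  have /eq_row/rowP/(_ o') : enum_val (enum_rank_in oX o) = enum_val (enum_rank_in oX' o).
    by rewrite !enum_rankK_in.
  rewrite !mxE !enum_rankK_in //; case: eqP => [<- _|_ /=].
    by have [_ /(_ (inr o))/negbTE -> _ _ _] := form;
       have [_ /(_ (inr o))/negbTE -> _ _ _] := form'.
  by case: (adj _ _); case: (adj _ _) => // /eqP; rewrite ?oner_eq0 // eq_sym oner_eq0.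
move=> o o'; have [oX|oX] := boolP (o \in X_outputs D); first exact: adjX.
have [oX'|oX'] := boolP (o' \in X_outputs D).
  have [-> _ _ _ _] := form; have [-> _ _ _ _] := form'; exact: adjX.
have noZ (E : diagram R n) : bipartite_rule E -> o \notin X_outputs E ->
    o' \notin X_outputs E -> @adj _ _ E (inr o) (inr o') = false.
  move=> bipE; rewrite !inE => /negbTE oZ /negbTE oZ'.
  by apply/negP => /bipE.2 /=; rewrite oZ oZ'.
by rewrite !noZ // -eqX.
Qed.

(** * CSS codes *)

Definition is_PauliX (l : pauli) : bool := if l is PauliX then true else false.
Definition is_PauliZ (l : pauli) : bool := if l is PauliZ then true else false.

(** [x_row] and [z_row] are the two halves of the binary symplectic vector of a Pauli operator
    without the letter Y. *)
Definition x_row n (P : npauli n) : 'rV['F_2]_n :=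
  \row_q (is_PauliX (pauli_letter P q))%:R.
Definition z_row n (P : npauli n) : 'rV['F_2]_n :=
  \row_q (is_PauliZ (pauli_letter P q))%:R.

Lemma prodr_sign (T : comPzRingType) (I : finType) (b : I -> bool) :
  \prod_i ((-1) ^+ b i : T) = (-1) ^+ (\sum_i ((b i)%:R : 'F_2) != 0).
Proof. by rewrite prodrXr -natr_sum F2_natr_eq0 negbK signr_odd. Qed.

Lemma pauli_opE (R : realType) n (P : npauli n) (psi : qstate R n) v :
    css_generator P ->
  pauli_op P psi (vecb v) =
    (-1) ^+ ((z_row P *m v) 0 0 != 0) * psi (vecb (v + (x_row P)^T)).
Proof.
move=> [sgn XZ].
have noY q : pauli_letter P q <> PauliY.
  by case: XZ => /(_ q) [] ->.
rewrite /pauli_op sgn expr0 scale1r.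
rewrite (@tensor_op_monomial _ _ _ (fun q => is_PauliX (pauli_letter P q))
  (fun q r => (-1) ^+ (is_PauliZ (pauli_letter P q) && r))) => [|q r c].
  rewrite prodr_sign !mxE; congr ((-1) ^+ nat_of_bool (_ != 0) * psi _).
    apply: eq_bigr => q _; rewrite !mxE ffunE [in RHS](F2_natb (v q 0)).
    by rewrite -natrM mulnb.
  apply/ffunP => q; rewrite !ffunE !mxE [in RHS](F2_natb (v q 0)).
  by case: (v q 0 != 0); case: is_PauliX.
case: (pauli_letter P q) (noY q) => //= _; rewrite !mxE ?(inj_eq bit_ord_inj).
- by rewrite addbF mulr1 eq_sym.
- by rewrite mulr1; case: r; case: c.
- by rewrite addbF eq_sym; case: r; case: c; rewrite /bit_ord ?inordK ?mulr1 ?mul0r.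
Qed.

Lemma pauli_op_comp (R : realType) n (P : npauli n) (B : 'End(qstate R n)) psi :
  (pauli_op P \o B)%VF psi = pauli_op P (B psi).
Proof. exact: comp_lfunE. Qed.

Lemma css_generator_row n (P : npauli n) :
  css_generator P -> x_row P = 0 \/ z_row P = 0.
Proof.
by case=> _ [] H; [left|right]; apply/rowP => q; rewrite !mxE; case: (H q) => ->.
Qed.

Lemma css_code_operators (R : realType) n (W : {vspace qstate R n}) : css_code W ->
  exists m (op : 'I_m -> 'End(qstate R n)) (z x : 'I_m -> 'rV['F_2]_n),
  [/\ forall i j, (op i \o op j)%VF = (op j \o op i)%VF,
      forall i psi v, op i psi (vecb v) =
        (-1) ^+ ((z i *m v) 0 0 != 0) * psi (vecb (v + (x i)^T)),
      forall i, x i = 0 \/ z i = 0 &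
      forall psi, psi \in W <-> forall i, op i psi = psi].
Proof.
move=> [m [g [[comm _ memW] css]]].
exists m, (fun i => pauli_op (g i)), (fun i => z_row (g i)), (fun i => x_row (g i)).
split=> //.
- by move=> i psi v; apply: pauli_opE.
- by move=> i; apply: css_generator_row.
have gen i : generated g setT (pauli_op (g i) : 'End(qstate R n)).
  rewrite -(comp_lfun1r (pauli_op (g i))).
  by apply: generated_mul (generated_one _ _); rewrite inE.
move=> psi; rewrite memW; split=> [stab i|fix_i A]; first exact: stab (gen i).
elim=> [|i B _ _ IH]; first exact: id_lfunE.
exact: etrans (pauli_op_comp _ _ _) (etrans (congr1 _ IH) (fix_i i)).
Qed.

(** Z generators act by signs and confine the support to the kernel of [Bz]; X generators act by
    translations along the rows of [Bx]. *)
Lemma css_code_rows (R : realType) n (W : {vspace qstate R n}) : css_code W ->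
  exists m (Bz Bx : 'M['F_2]_(m, n)), Bz *m Bx^T = 0 /\
    forall psi : qstate R n, psi \in W <->
      (forall v : 'cV_n, Bz *m v != 0 -> psi (vecb v) = 0) /\
      (forall (v : 'cV_n) u, psi (vecb (v + (u *m Bx)^T)) = psi (vecb v)).
Proof.
move=> /css_code_operators [m [op [z [x [comm opE css memW]]]]].
(* For [i] of X type and [j] of Z type, the two orders of application to the constant state differ
   at 0 by the sign of [z j *m (x i)^T]. *)
have zx i j : z j *m (x i)^T = 0.
  have [->|zi] := css i; first by rewrite trmx0 mulmx0.
  have [xj|->] := css j; last by rewrite mul0mx.
  pose psi : qstate R n := [ffun=> 1].
  have swap : op i (op j psi) = op j (op i psi) by rewrite -!comp_lfunE comm.
  have := congr1 (fun phi : qstate R n => phi (vecb 0)) swap.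
  rewrite /= !opE /psi !ffunE xj zi trmx0 !mul0mx mulmx0 add0r.
  rewrite [(0 : 'M_(_, _)) 0 0]mxE eqxx /= !mulr1 mul1r => sgn1.
  apply/matrixP => a b; rewrite !ord1 [RHS]mxE; apply/eqP/negPn/negP => nz.
  by move/eqP: sgn1; rewrite nz expr1 -subr_eq0 -opprD oppr_eq0 (pnatr_eq0 _ 2).
exists m, (\matrix_i z i), (\matrix_i x i); split.
  apply/matrixP => i j; transitivity ((z i *m (x j)^T) 0 0); last by rewrite zx !mxE.
  by rewrite !mxE; apply: eq_bigr => q _; rewrite !mxE.
have rowZ (v : 'cV_n) i : ((\matrix_i z i) *m v) i 0 = (z i *m v) 0 0.
  by rewrite !mxE; apply: eq_bigr => q _; rewrite !mxE.
move=> psi; rewrite memW; split=> [fix_i|[supp inv] i].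
  split=> [v /eqP nz|v u].
    have [i nzi] : exists i, (z i *m v) 0 0 != 0.
      apply/existsP; apply: contra_notT nz => /existsPn z0; apply/colP => i.
      by rewrite rowZ [RHS]mxE; apply/eqP/negPn/z0.
    (* At a point violating check [i], a fixed state satisfies [psi = - psi]. *)
    have := opE i psi v; rewrite fix_i nzi.
    have [->|zi] := css i; last by move: nzi; rewrite zi mul0mx mxE eqxx.
    by rewrite trmx0 addr0 expr1 mulN1r => /esym/eqP; rewrite eqNr => /eqP.
  rewrite mulmx_sum_row; elim/big_rec: _ v => [|i w _ IH] v; first by rewrite trmx0 addr0.
  rewrite linearD /= addrA IH rowK.
  have [->|zi] := css i; first by rewrite scaler0 trmx0 addr0.
  rewrite (F2_natb (u 0 i)); case: (u 0 i != 0); last by rewrite scale0r trmx0 addr0.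
  by have := opE i psi v; rewrite fix_i zi mul0mx mxE eqxx mul1r scale1r.
apply/ffunP => y; rewrite -[y]bvecK opE.
have -> : x i = delta_mx 0 i *m \matrix_i x i by rewrite -rowE rowK.
rewrite inv; case: eqP => [_|nz]; first by rewrite mul1r.
rewrite supp ?mulr0 //; apply/eqP => /colP/(_ i).
by rewrite rowZ [RHS]mxE.
Qed.

(** * Existence *)

(** Row [p] of [S] lists the neighbours of the X output [p], and row [q] of [T] those of the input
    with pivot [q]. The pivot entry of [S] becomes the self-mark in [outputX_mx] instead of an
    edge. *)
Definition css_edge n (P Q : {set 'I_n}) (S T : 'M['F_2]_n)
    (u v : 'I_#|Q| + 'I_n) : bool :=
  match u, v with
  | inl _, inl _ => false
  | inl i, inr o | inr o, inl i => T (enum_val i) o != 0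
  | inr o, inr o' => if o \in P then (o' \notin P) && (S o o' != 0)
                     else (o' \in P) && (S o' o != 0)
  end.

Definition css_diagram (R : realType) n (P Q : {set 'I_n}) (S T : 'M['F_2]_n) :
    diagram R n :=
  {| nin := #|Q|;
     node_color := [ffun v => if v is inr o then if o \in P then XColor else ZColor
                              else XColor];
     node_phase := [ffun=> 0];
     edges := [set uv | css_edge P S T uv.1 uv.2];
     local_op := [ffun=> 1%:M] |}.

Section CssDiagram.
Context (R : realType) (n : nat) (P Q : {set 'I_n}) (S T : 'M['F_2]_n).
Hypotheses (Sred : reduced_on P S) (Tred : reduced_on Q T)
  (T0 : forall q p, q \in Q -> p \in P -> T q p = 0).
Let D := css_diagram R P Q S T.

Lemma css_adjE u v : @adj _ _ D u v = css_edge P S T u v.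
Proof. by rewrite /adj inE. Qed.

Lemma css_X_outputs : X_outputs D = P.
Proof. by apply/setP => o; rewrite inE ffunE; case: (o \in P). Qed.

Lemma css_in_mx i o : in_mx D i o = T (enum_val i) o.
Proof. by rewrite mxE css_adjE /= -F2_natb. Qed.

Lemma css_outputX_mx i o : outputX_mx D i o = S (enum_val i) o.
Proof.
have iP : enum_val i \in P by rewrite -css_X_outputs enum_valP.
rewrite mxE css_adjE /= iP; have [oP|oP] := boolP (o \in P).
  by rewrite Sred.1 // orbF.
have -> : (enum_val i == o) = false by apply: contraNF oP => /eqP <-.
by rewrite /= -F2_natb.
Qed.

Lemma css_pivots_disjoint q : q \in Q -> q \notin P.
Proof.
move=> qQ; apply/negP => /(T0 qQ); rewrite Tred.1 // eqxx => /eqP.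
by rewrite oner_eq0.
Qed.

Lemma css_encoder_respecting : encoder_respecting D.
Proof.
split.
- move=> [i|o] [j|o']; rewrite !css_adjE //=.
  by case: (o \in P); case: (o' \in P).
- by move=> [i|o]; rewrite css_adjE //=; case: (o \in P).
- by move=> i j; rewrite css_adjE.
- by move=> u; rewrite ffunE lexx mulr_gt0 // pi_gt0.
- by move=> o; rewrite ffunE; apply/unitarymxP; rewrite mul1mx trmx1 map_mx1.
Qed.

Lemma css_bipartite : bipartite_rule D.
Proof.
have XE o : is_X (node_color D (inr o)) = (o \in P).
  by rewrite ffunE; case: (o \in P).
split=> [i|]; first by rewrite ffunE.
move=> [i|o] [j|o']; rewrite css_adjE //= ?XE.
- by have [/(T0 (enum_valP i)) ->|] := boolP (o' \in P); rewrite ?eqxx.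
- by have [/(T0 (enum_valP j)) ->|] := boolP (o \in P); rewrite ?eqxx.
- by case: ifP => _ /andP [] => [/negbTE ->|->].
Qed.

Lemma css_phase_free : phase_free_rule D.
Proof. by split=> u; rewrite ffunE. Qed.

Lemma css_rref : rref_rule D.
Proof.
split.
- have -> : input_Z_mx D =
      mxsub (fun i : 'I_#|Q| => enum_val i) (fun j : 'I_#|Z_outputs D| => enum_val j) T.
    by apply/matrixP => i j; rewrite !mxE css_adjE /= -F2_natb.
  apply: (rref_mxsub Tred); try exact: increasing_enum_val.
    by move=> i; apply: enum_valP.
  (* The pivots of [T] avoid [P], so restricting to the Z columns keeps all of them. *)
  move=> i; have iZ : enum_val i \in Z_outputs D.
    by rewrite inE css_X_outputs css_pivots_disjoint ?enum_valP.
  by exists (enum_rank_in iZ (enum_val i)); rewrite enum_rankK_in.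
- have -> : outputX_mx D = mxsub (fun i : 'I_#|X_outputs D| => enum_val i) id S.
    by apply/matrixP => i j; rewrite css_outputX_mx mxE.
  apply: (rref_mxsub Sred) => //.
  + exact: increasing_enum_val.
  + by move=> i; rewrite -css_X_outputs enum_valP.
  + by move=> i; exists (enum_val i).
- move=> o o' oX; have oP : o \in P by rewrite -css_X_outputs.
  rewrite css_adjE /= oP => _ /andP [o'P nz].
  case: ltngtP => // [lt|e]; first by rewrite Sred.2 ?eqxx in nz.
  by move: o'P; rewrite -(val_inj e) oP.
Qed.

Lemma css_outputX_ker (v : 'cV['F_2]_n) :
  outputX_mx D *m v = 0 <-> forall p, p \in P -> row p S *m v = 0.
Proof.
split=> [Hv p pP|H]; last first.
  apply/row_matrixP => i; rewrite row_mul row0.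
  have -> : row i (outputX_mx D) = row (enum_val i) S.
    by apply/rowP => o; rewrite !mxE -css_outputX_mx mxE.
  by apply: H; rewrite -css_X_outputs enum_valP.
have pX : p \in X_outputs D by rewrite css_X_outputs.
have -> : row p S = row (enum_rank_in pX p) (outputX_mx D).
  by apply/rowP => o; rewrite [LHS]mxE [RHS]mxE css_outputX_mx enum_rankK_in.
by rewrite -row_mul Hv row0.
Qed.

Lemma css_in_ker (v : 'cV['F_2]_n) :
  in_mx D *m v = 0 <-> forall q, q \in Q -> row q T *m v = 0.
Proof.
have rowE' i : row i (in_mx D) = row (enum_val i) T.
  by apply/rowP => o; rewrite [LHS]mxE [RHS]mxE css_in_mx.
split=> [Av q qQ|H].
  by rewrite -(enum_rankK_in qQ qQ) -rowE' -row_mul Av row0.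
by apply/row_matrixP => i; rewrite row_mul row0 rowE'; apply/H/enum_valP.
Qed.

(** Placing [x] on the pivots of [T] solves [A w = x]; adjusting the X output bits then achieves
    [H c = 0] without changing [A w]. *)
Lemma css_injective : injective_encoder D.
Proof.
apply/(injective_encoderP css_encoder_respecting css_bipartite css_phase_free) => x.
pose w : 'cV['F_2]_n := \sum_i x i 0 *: delta_mx (enum_val i) 0.
have [c [Hc cw]] := outputX_solution css_bipartite css_rref w.
exists c; split=> //; rewrite (in_mx_eq css_bipartite cw).
apply/colP => i; rewrite mulmx_sumr summxE (bigD1 i) //= big1 ?addr0 => [|j ji].
  rewrite -scalemxAr mulmx_delta_col !mxE css_adjE /= -F2_natb.
  by rewrite Tred.1 ?enum_valP // eqxx mulr1.
rewrite -scalemxAr mulmx_delta_col [LHS]mxE [X in _ * X]mxE css_in_mx.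
rewrite Tred.1 ?enum_valP // (inj_eq enum_val_inj) eq_sym.
by rewrite (negbTE ji) mulr0.
Qed.

End CssDiagram.

(** [S] reduces [Bz], with pivots [P]. As inputs must avoid X outputs, [T] reduces a system that
    ignores the coordinates in [P]; this loses nothing, because a vector in the kernel of [Bz] is
    determined by its coordinates outside [P]. *)
Lemma css_rows_diagram (R : realType) m n (Bz Bx : 'M['F_2]_(m, n)) :
    Bz *m Bx^T = 0 ->
  exists D : diagram R n, [/\ encoder_respecting D, injective_encoder D,
    bipartite_rule D, phase_free_rule D & rref_rule D] /\
    forall psi : qstate R n, codespace_mem D psi <->
      (forall v : 'cV_n, Bz *m v != 0 -> psi (vecb v) = 0) /\
      (forall (v : 'cV_n) u, psi (vecb (v + (u *m Bx)^T)) = psi (vecb v)).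
Proof.
move=> ZX0; have [P [S [Sred Sker]]] := reduced_exists Bz.
(* A vector is in the row space of [Bx] modulo the coordinates in [P]
   if and only if the matrix [M] below annihilates it. *)
pose E : 'M['F_2]_n := diag_mx (\row_p (p \in P)%:R).
pose M := (cokermx (Bx + E)%MS)^T.
have MP (v : 'cV['F_2]_n) : M *m v = 0 <-> (v^T <= Bx + E)%MS.
  rewrite submxE; split=> [Mv|/eqP cv]; last by rewrite -[v]trmxK -trmx_mul cv trmx0.
  by rewrite -[v^T *m _]trmxK trmx_mul trmxK -/M Mv trmx0.
have [Q [T [Tred Tker]]] := reduced_exists M.
have T0 q p : q \in Q -> p \in P -> T q p = 0.
  move=> qQ pP; have /Tker/(_ q qQ)/matrixP/(_ 0 0) : M *m (delta_mx p 0 : 'cV_n) = 0.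
    apply/MP/(submx_trans _ (addsmxSr Bx E))/submxP; exists (delta_mx 0 p).
    rewrite -rowE trmx_delta; apply/rowP => j; rewrite !mxE eqxx pP.
    by rewrite eq_sym; case: eqP.
  by rewrite mulmx_delta_col !mxE.
pose D := css_diagram R P Q S T.
have kerH (v : 'cV_n) : outputX_mx D *m v = 0 <-> Bz *m v = 0.
  exact: iff_trans (css_outputX_ker R Q T Sred v) (iff_sym (Sker v)).
have kerA (c : 'cV_n) : Bz *m c = 0 -> in_mx D *m c = 0 <-> exists u, c = (u *m Bx)^T.
  move=> Zc; rewrite /D css_in_ker -Tker MP; split=> [/sub_addsmxP [[u w] /= uwE]|[u ->]]; last first.
    by rewrite trmxK; apply: submx_trans (submxMl _ _) (addsmxSl _ _).
  exists u.
  have ZcB : Bz *m (c - (u *m Bx)^T) = 0.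
    by rewrite mulmxBr Zc trmx_mul mulmxA ZX0 mul0mx subrr.
  apply/eqP; rewrite -subr_eq0; apply/eqP/colP => p; rewrite [RHS]mxE.
  (* The difference [d] is in the kernel of [Bz] and vanishes outside [P], so row [p] of [S] reduces
     to the equation that entry [p] of [d] is 0. *)
  set d := c - _ in ZcB *.
  have d0 j : j \notin P -> d j 0 = 0.
    move=> jP; rewrite /d -[c]trmxK uwE linearD /= addrAC subrr add0r.
    by rewrite mxE mul_mx_diag !mxE (negbTE jP) mulr0.
  clearbody d; have [pP|/d0 //] := boolP (p \in P).
  have /Sker/(_ p pP)/matrixP/(_ 0 0) := ZcB; rewrite !mxE (bigD1 p) //= big1 => [|j jp].
    by rewrite addr0 mxE Sred.1 // eqxx mul1r => ->.
  rewrite mxE; have [jP|/d0 ->] := boolP (j \in P); last by rewrite mulr0.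
  by rewrite Sred.1 // eq_sym (negbTE jp) mul0r.
exists D; split.
  split; [exact: css_encoder_respecting|exact: css_injective|exact: css_bipartite
    |exact: css_phase_free|exact: css_rref].
move=> psi; split=> -[supp const]; split=> [v nz|v v'].
- by apply: supp; apply: contra nz => /eqP/kerH ->.
- have Zv' : Bz *m (v + (v' *m Bx)^T) = Bz *m v.
    by rewrite mulmxDr trmx_mul mulmxA ZX0 mul0mx addr0.
  (* Outside the kernel of [Bz] both values are 0; inside it, [A] takes the same value at both
     points. *)
  have [Zv|nz] := eqVneq (Bz *m v) 0; last first.
    by rewrite !supp //; apply: contra nz => /eqP/kerH/eqP; rewrite ?Zv'.
  apply: const; [by apply/kerH; rewrite Zv'|exact/kerH|].
  apply/eqP; rewrite -subr_eq0 -mulmxBr addrAC subrr add0r; apply/eqP/kerA.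
    by rewrite trmx_mul mulmxA ZX0 mul0mx.
  by exists v'.
- by apply: supp; apply: contra nz => /eqP/kerH ->.
- move=> /kerH Zv /kerH Zv' e.
  have /kerA : Bz *m (v' - v) = 0 by rewrite mulmxBr Zv Zv' subrr.
  rewrite mulmxBr e subrr => -[/(_ erefl) [u uE] _].
  by rewrite -[v'](subrK v) uE addrC const.
Qed.

Theorem theorem3p2 (R : realType) (n : nat) (W : {vspace qstate R n}) :
  css_code W ->
  exists! D : diagram R n,
    (encoder_respecting D /\ injective_encoder D) /\
    (bipartite_rule D /\ phase_free_rule D /\ rref_rule D) /\
    expresses D W.
Proof.
move=> /css_code_rows [m [Bz [Bx [ZX0 memW]]]].
have [D [[form inj bip free rr] memD]] := css_rows_diagram R ZX0.
have imgD : limg (diagram_map D) = W.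
  apply/vspaceP => psi; apply/idP/idP.
    by move=> /(mem_limg_diagram form bip free psi inj)/memD/memW.
  by move=> /memW/memD/(mem_limg_diagram form bip free psi inj).
exists D; split=> // D' [[form' inj'] [[bip' [free' rr']] imgD']].
by apply: canonical_diagram_unique => //; rewrite imgD.
Qed.
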